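(* Let $G(m,n)=\frac{3m^2+m}{2}+2mn+n^2$. For every non-negative integer $N$, \[ \sum_{m,n\geq 0}q^{G(m,n)}{2N-2m-2n+2 \brack m}_q{N-m-n+1+\lfloor n/2\rfloor \brack \lfloor n/2\rfloor}_{q^4}=\sum_{m,n\geq 0} q^{m^2+n^2}{N-m+1\brack n}_{q^2}{n\brack m}_{q^2}, \] and \[ \sum_{m,n\geq 0}q^{G(m,n)+2m+2n}{2N-2m-2n \brack m}_q{N-m-n+\lfloor n/2\rfloor \brack \lfloor n/2\rfloor}_{q^4}=\sum_{m,n\geq 0} q^{m^2+n^2+2n}{N-m\brack n}_{q^2}{n\brack m}_{q^2}. \]
   Context: $(a;q)_k=\prod_{i=0}^{k-1}(1-aq^i)$. For integers $A,B$ and a base $p$ (here $p=q,q^2,q^4$), the $p$-binomial coefficient is ${A\brack B}_p=\frac{(p;p)_A}{(p;p)_B(p;p)_{A-B}}$ if $0\le B\le A$, and ${A\brack B}_p=0$ otherwise. $\lfloor\cdot\rfloor$ is the floor function. Both sides are polynomials in $q$. *)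

(* Defs.v *)
From mathcomp Require Import all_boot all_order all_algebra.
From mathcomp Require Import classical_sets fsbigop.

Set Implicit Arguments.
Unset Strict Implicit.
Unset Printing Implicit Defensive.

Import Order.TTheory GRing.Theory Num.Theory.
Local Open Scope classical_set_scope.
Local Open Scope ring_scope.

(* q is a formal variable: identities between polynomials in q are stated in
   the field Q(q), where the quotients of q-factorials are honest quotients. *)
Definition Qq : fieldType := {fraction {poly rat}}.
Definition q : Qq := FracField.tofrac 'X.

(* (a; p)_k *)
Definition qpoch (a p : Qq) (k : nat) : Qq := \prod_(i < k) (1 - a * p ^+ i).

(* The arguments are integers, not naturals: in the sums the top argument can
   be negative, and truncating it at 0 would create spurious terms
   (['C(0, 0) = 1]). The absolute values are only taken of nonnegative
   integers. *)
Definition qbinom (p : Qq) (A B : int) : Qq :=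
  if (0 <= B) && (B <= A) then
    qpoch p p `|A|%N / (qpoch p p `|B|%N * qpoch p p `|A - B|%N)
  else 0.

(* The sum over all m, n >= 0 of a family with finite support; [fsbigop] gives
   0 for infinite supports, but in every use below the q-binomials vanish for
   all but finitely many (m, n). *)
Definition dsum (f : nat -> nat -> Qq) : Qq :=
  \sum_(mn \in [set: nat * nat]) f mn.1 mn.2.

(* [3 m ^ 2 + m] is even, so the halving is exact. *)
Definition G (m n : nat) : nat :=
  ((3 * m ^ 2 + m)./2 + 2 * m * n + n ^ 2)%N.

(* Main.v *)
(* Weight the left summand by x^(m+n) and the right one by x^n; the identity
   survives this refinement, with x = 1, L = N + 1 and x = q^2, L = N giving the
   two claims. Since G(m, k - m) = k^2 + m(m+1)/2, comparing the coefficients of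
   x^k leaves a convolution identity in M = L - k. Its left side is generated by
     (1 + z) (-zq; q)_(2M) / (z^2; q^4)_(M+1)
   (the factor 1 + z accounts for the floor of n/2) and its right side by
     (-zq; q^2)_M / (z; q^2)_(M+1).
   These agree: (1 + z) (-zq; q)_(2M) = (-z; q^2)_(M+1) (-zq; q^2)_M, and
   (z^2; q^4)_(M+1) = (z; q^2)_(M+1) (-z; q^2)_(M+1). Power series in z are
   replaced by polynomials modulo a power of z. *)

Require Import Defs.
From mathcomp Require Import all_boot all_order all_algebra.
From mathcomp Require Import classical_sets fsbigop ring zify.

Set Implicit Arguments.
Unset Strict Implicit.
Unset Printing Implicit Defensive.

Import GRing.Theory.
Local Open Scope ring_scope.

(** * Truncated power series and finite double sums *)

Lemma dvdp_XnP (F : fieldType) (n : nat) (P : {poly F}) :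
  'X^n %| P <-> forall i, (i < n)%N -> P`_i = 0.
Proof.
split=> [/dvdpP [Q ->] i ni | P0]; first by rewrite coefMXn ni.
rewrite -(poly_take_drop n P) dvdp_addr ?dvdp_mull //.
suff -> : take_poly n P = 0 by exact: dvdp0.
by apply/polyP => i; rewrite coef_take_poly coef0; case: ifP => // /P0.
Qed.

Lemma coef_linearM (R : comNzRingType) (c : R) (P : {poly R}) (i : nat) :
  ((1 + c%:P * 'X) * P)`_i = P`_i + c * (if i == 0%N then 0 else P`_i.-1).
Proof. by rewrite mulrDl mul1r -mulrA coefD coefCM coefXM. Qed.

(** Makes the sum over all pairs finite and groups it by [k]: the triangle [j <= k <= L] covers the
    support through [h], and injectivity there prevents double counting. *)
Lemma dsum_reindex (f : nat -> nat -> Qq) (h : nat -> nat -> nat * nat) (L : nat) :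
  (forall k k' m m', (m <= k)%N -> (m' <= k')%N -> h k m = h k' m' ->
     k = k' /\ m = m') ->
  (forall m n, f m n != 0 -> exists k j,
     [/\ (k <= L)%N, (j <= k)%N & (m, n) = h k j]) ->
  dsum f = \sum_(k < L.+1) \sum_(j < k.+1) f (h k j).1 (h k j).2.
Proof.
move=> h_inj f_supp; rewrite /dsum.
pose s := [seq h k j | k <- iota 0 L.+1, j <- iota 0 k.+1].
rewrite (@fsbigE _ _ _ _ _ s) //.
- rewrite (eq_bigl xpredT); last by move=> x; rewrite in_setT.
  rewrite big_allpairs_dep -[iota 0 _]/(index_iota 0 L.+1) big_mkord.
  by apply: eq_bigr => k _; rewrite -[iota 0 _]/(index_iota 0 k.+1) big_mkord.
- apply: (@allpairs_uniq_dep _ (fun=> nat)); first exact: iota_uniq.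
    by move=> k _; exact: iota_uniq.
  move=> _ _ /allpairsPdep [k [j [_ + ->]]] /allpairsPdep [k' [j' [_ + ->]]].
  rewrite !mem_iota !ltnS => jk jk' /(h_inj _ _ _ _ jk jk') [kk' jj'].
  by rewrite kk' jj'.
- move=> [m n] _ mn_s; apply/eqP/negP => /negP /f_supp [k [j [kL jk mnE]]].
  case/negP: mn_s; apply/allpairsPdep; exists k, j.
  by rewrite !mem_iota !ltnS.
Qed.

(** * q-binomials and products (-xz; b)_M *)

Lemma qpochS a p k : qpoch a p k.+1 = qpoch a p k * (1 - a * p ^+ k).
Proof. by rewrite /qpoch big_ord_recr. Qed.

Lemma qbinom_small p (A B : int) : A < B -> qbinom p A B = 0.
Proof. by rewrite /qbinom; case: ifP => //; lia. Qed.

Lemma qbinom_addn p (m n : nat) :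
  qbinom p (m + n)%N n = qpoch p p (m + n) / (qpoch p p n * qpoch p p m).
Proof.
rewrite /qbinom ifT; last by lia.
by congr (qpoch _ _ _ / (_ * qpoch _ _ _)); lia.
Qed.

(** Ensures that no [qpoch p p k] vanishes, so that quotients in [qbinom] can be cancelled. *)
Definition free_base (p : Qq) : Prop := forall i, p ^+ i.+1 != 1.

Lemma free_base_q i : free_base (q ^+ i.+1).
Proof.
move=> j; rewrite -exprM -tofracXn -tofrac1 tofrac_eq mulSn addSn.
by apply/eqP => /(congr1 (fun P : {poly rat} => P`_0)); rewrite coefXn coef1.
Qed.

(* (-xz; b)_M *)
Definition qprod (R : comNzRingType) (x b : R) (M : nat) : {poly R} :=
  \prod_(i < M) (1 + (x * b ^+ i)%:P * 'X).

Lemma qprodS (R : comNzRingType) (x b : R) M :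
  qprod x b M.+1 = qprod x b M * (1 + (x * b ^+ M)%:P * 'X).
Proof. by rewrite /qprod big_ord_recr. Qed.

Lemma qprod0 (R : comNzRingType) (x b : R) : qprod x b 0 = 1.
Proof. by rewrite /qprod big_ord0. Qed.

(** Factor by factor, (1 + b^i z)(1 - b^i z) = 1 - b^(2i) z^2. *)
Lemma qprod_comp_sq (R : comNzRingType) (b : R) M :
  qprod (-1) (b ^+ 2) M \Po 'X^2 = qprod 1 b M * qprod (-1) b M.
Proof.
elim: M => [|M IH]; first by rewrite !qprod0 mulr1 comp_polyC.
rewrite !qprodS comp_polyM IH comp_polyD comp_polyM !comp_polyC comp_polyX.
by rewrite mul1r !mulN1r !polyCN exprAC expr2 polyCM; ring.
Qed.

(** Both sides are (-z; b)_(2M+1); the right one separates even and odd powers of b. *)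
Lemma qprod_dissect (R : comNzRingType) (b : R) M :
  qprod b b (2 * M) * (1 + 'X) = qprod 1 (b ^+ 2) M.+1 * qprod b (b ^+ 2) M.
Proof.
elim: M => [|M IH]; first by rewrite muln0 qprodS !qprod0 !mul1r mulr1.
rewrite mulnS add2n !qprodS [LHS]mulrAC [X in X * _]mulrAC IH qprodS.
by rewrite mul1r -!exprM mulnS !add2n !exprS !polyCM; ring.
Qed.

(** * q-Pascal rule and generating functions *)

Section Base.
Variables (p : Qq) (pP : free_base p).

Lemma qpoch_neq0 k : qpoch p p k != 0.
Proof.
by apply/prodf_neq0 => i _; rewrite -exprS subr_eq0 eq_sym; exact: pP.
Qed.

Lemma qbinom_n0 (n : nat) : qbinom p n 0%N = 1.
Proof.
rewrite -{1}[n]addn0 qbinom_addn addn0 {2}/qpoch big_ord0 mul1r divff //.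
exact: qpoch_neq0.
Qed.

Lemma qbinom_nn (n : nat) : qbinom p n n = 1.
Proof.
have := qbinom_addn p 0 n; rewrite add0n => ->.
by rewrite [qpoch _ _ 0]big_ord0 mulr1 divff // qpoch_neq0.
Qed.

Lemma qbinomS (m n : nat) :
  qbinom p (m.+1 + n.+1)%N n.+1
  = qbinom p (m + n.+1)%N n.+1 + p ^+ m.+1 * qbinom p (m.+1 + n)%N n.
Proof.
have pn i : 1 - p ^+ i.+1 != 0 by rewrite subr_eq0 eq_sym; exact: pP.
(* With u = p^(m+1) and v = p^(n+1), this is 1 - uv = (1 - u) + u(1 - v). *)
have key (F : fieldType) (a b c u v : F) : a != 0 -> b != 0 -> 1 - u != 0 ->
    1 - v != 0 -> c * (1 - u * v) / (b * (1 - v) * (a * (1 - u)))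
    = c / (b * (1 - v) * a) + u * (c / (b * (a * (1 - u)))).
  by move=> a0 b0 u0 v0; field; rewrite u0 v0 b0 a0.
rewrite !qbinom_addn [(m.+1 + n)%N]addSnnS addSn !qpochS -!exprS -addSn exprD.
exact: key (qpoch_neq0 m) (qpoch_neq0 n) (pn m) (pn n).
Qed.

Lemma qbinom_pascal (n k : nat) : (k <= n)%N ->
  qbinom p n.+1 k.+1 = qbinom p n k.+1 + p ^+ (n - k) * qbinom p n k.
Proof.
move=> kn; have [m ->] : exists m, n = (m + k)%N by exists (n - k)%N; lia.
rewrite addnK; case: m => [|m]; last by rewrite -addnS qbinomS addSnnS.
rewrite add0n expr0 mul1r (@qbinom_small p k) ?add0r; last by lia.
by rewrite !qbinom_nn.
Qed.

(* A truncation of 1 / (z; p)_(M+1), by the lemma [qseries_inv]. *)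
Definition qseries (b : Qq) (M K : nat) : {poly Qq} :=
  \poly_(j < K) qbinom b (M + j)%N j.

(** The q-binomial theorem; the last factor of the product yields the q-Pascal rule. *)
Lemma coef_qprod x M i :
  (qprod x p M)`_i = p ^+ 'C(i, 2) * x ^+ i * qbinom p M i.
Proof.
elim: M i => [|M IH] i.
  rewrite /qprod big_ord0 coef1; case: i => [|i]; last first.
    by rewrite qbinom_small ?mulr0 //; lia.
  by rewrite qbinom_n0 !expr0 !mulr1.
rewrite /qprod big_ord_recr /= -/(qprod _ _ _) mulrC coef_linearM !IH.
case: i => [|i] /=.
  by rewrite !qbinom_n0 mulr0 addr0.
case: (leqP i M) => iM; last by rewrite !qbinom_small ?mulr0 ?addr0 //; lia.
rewrite qbinom_pascal // mulrDr; congr (_ + _).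
rewrite binS bin1 exprD exprS -{1}(subnK iM) exprD.
by move: (p ^+ _) (x ^+ _) => *; ring.
Qed.

(** For M = 0 this is the geometric series. Modulo z^K, the new factor 1 - p^(M+1) z turns the
    series for M + 1 into the one for M, by [qbinomS]. *)
Lemma qseries_inv M K : 'X^K %| qprod (-1) p M.+1 * qseries p M K - 1.
Proof.
elim: M => [|M IH].
  rewrite /qprod big_ord1; apply/dvdp_XnP => i iK.
  rewrite coefB coef_linearM coef1 !coef_poly iK.
  by case: i iK => [|i] iK /=; rewrite ?(ltnW iK) !qbinom_nn; ring.
rewrite {1}/qprod big_ord_recr /= -/(qprod _ _ M.+1) -mulrA.
have key (P S T : {poly Qq}) : P * T - 1 = P * (T - S) + (P * S - 1) by ring.
rewrite (key _ (qseries p M K)) dvdp_addl // dvdp_mull //.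
apply/dvdp_XnP => i iK; rewrite coefB coef_linearM !coef_poly iK.
case: i iK => [|i] iK /=; first by rewrite !qbinom_n0; ring.
by rewrite (ltnW iK) qbinomS; ring.
Qed.

(** Both sides are the trinomial (p;p)_(M+k-j) / ((p;p)_j (p;p)_(k-j) (p;p)_(M-j)), or 0 when j >
    M. *)
Lemma qbinom_swap (M k j : nat) : (j <= k)%N ->
  qbinom p (M + k - j)%N k * qbinom p k j
  = qbinom p M j * qbinom p (M + (k - j))%N (k - j)%N.
Proof.
move=> jk; case: (leqP j M) => jM; last first.
  by rewrite qbinom_small ?[qbinom p M j]qbinom_small ?mul0r //; lia.
have [i ->] : exists i, k = (i + j)%N by exists (k - j)%N; lia.
have [a ->] : exists a, M = (a + j)%N by exists (M - j)%N; lia.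
have -> : (a + j + (i + j) - j = a + (i + j))%N by lia.
rewrite addnK !qbinom_addn -addnA [(j + i)%N]addnC.
have key (F : fieldType) (u v w c d e : F) : u != 0 -> v != 0 -> w != 0 ->
    d != 0 -> e != 0 ->
    c / (u * v) * (u / (w * d)) = e / (w * v) * (c / (d * e)).
  by move=> *; field; do !(apply/andP; split).
by apply: key; exact: qpoch_neq0.
Qed.

End Base.

(** * The convolution identity *)

Lemma dvdp_dissect (F : fieldType) (D A B C P Q S T : {poly F}) :
  P * Q = A * C -> D %| A * B * S - 1 -> D %| B * T - 1 ->
  D %| P * (Q * S) - C * T.
Proof.
(* Modulo D, S inverts AB and T inverts B, so PQS = ACS = CT. *)
move=> PQ DS DT; have -> : P * (Q * S) - C * T
    = C * T * (A * B * S - 1) - S * (A * C) * (B * T - 1).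
  by rewrite mulrA PQ; ring.
by rewrite dvdp_sub ?dvdp_mull.
Qed.

(* Both sides are the coefficient of z^k in (-zq; q^2)_M / (z; q^2)_(M+1). *)
Lemma convolution (M k : nat) :
  \sum_(m < k.+1) q ^+ ('C(m, 2) + m) * qbinom q (2 * M)%N m
     * qbinom (q ^+ 4) (M + (k - m)./2)%N (k - m)./2
  = \sum_(m < k.+1) q ^+ (m ^ 2)
     * (qbinom (q ^+ 2) M m * qbinom (q ^+ 2) (M + (k - m))%N (k - m)%N).
Proof.
have f1 : free_base q := free_base_q 0.
have f2 : free_base (q ^+ 2) := free_base_q 1.
have f4 : free_base (q ^+ 4) := free_base_q 3.
(* A truncation of 1 / (z^2; q^4)_(M+1). *)
pose S := qseries (q ^+ 4) M k.+1 \Po 'X^2.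
have DS : 'X^(k.+1) %| qprod 1 (q ^+ 2) M.+1 * qprod (-1) (q ^+ 2) M.+1 * S - 1.
  have := dvdp_comp_poly 'X^2 (qseries_inv f4 M k.+1).
  rewrite comp_polyB comp_polyM comp_polyC comp_Xn_poly -/S.
  rewrite [q ^+ 4](exprM q 2 2) qprod_comp_sq; apply: dvdp_trans.
  by rewrite -exprM dvdp_exp2l // leq_pmull.
have /dvdp_XnP/(_ k (leqnn _)) :=
  dvdp_dissect (qprod_dissect q M) DS (qseries_inv f2 M k.+1).
rewrite coefB => /eqP; rewrite subr_eq0 => /eqP; rewrite !coefM.
(* [S] is even in z, so the factor 1 + z copies its coefficient of z^(2j) to z^(2j+1). *)
have coefS i : (i <= k)%N ->
    ((1 + 'X) * S)`_i = qbinom (q ^+ 4) (M + i./2)%N i./2.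
  move=> ik; have -> : 1 + 'X = 1 + 1%:P * 'X :> {poly Qq} by rewrite mul1r.
  rewrite coef_linearM mul1r !coef_comp_poly_Xn // !coef_poly !divn2 !dvdn2.
  case: i ik => [|i] ik /=; first by rewrite addr0.
  rewrite uphalf_half; case: (odd i) => /=.
    by rewrite add1n addr0 ifT //; lia.
  by rewrite add0n add0r ifT //; lia.
under eq_bigr => i _ do rewrite (coef_qprod f1) coefS ?leq_subr // -exprD.
move=> ->; apply: eq_bigr => i _.
rewrite (coef_qprod f2) coef_poly ltnS leq_subr [RHS]mulrA; congr (_ * _ * _).
rewrite -(exprM q) -(exprD q); congr (_ ^+ _).
(* From 2 C(i,2) = i(i-1), the exponent 2 C(i,2) + i is i^2. *)
have := mul_bin_diag i 1; rewrite bin1 => e.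
by case: (i : nat) e => [|j] //= e; lia.
Qed.

(** * Summation over k *)

Lemma G_diag (k j : nat) : (j <= k)%N ->
  G j (k - j) = (k ^ 2 + ('C(j, 2) + j))%N.
Proof.
move=> jk; have [n ->] : exists n, k = (n + j)%N by exists (k - j)%N; lia.
have := mul_bin_diag j 1; rewrite bin1 addnK /G => b.
have -> : (3 * j ^ 2 + j = ('C(j, 2) + j + j ^ 2).*2)%N.
  by case: j b {jk} => [|i] //= b; lia.
by rewrite doubleK; lia.
Qed.

(** Group the left side by k = m + n and the right side by k = n; the groups agree for each k by
    [convolution] with M = L - k. *)
Lemma dsum_identity (L : nat) (x : Qq) :
  dsum (fun m n =>
    q ^+ G m n * x ^+ (m + n)
    * qbinom q (2 * L%:Z - 2 * m%:Z - 2 * n%:Z) m%:Z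
    * qbinom (q ^+ 4) (L%:Z - m%:Z - n%:Z + (n./2)%:Z) (n./2)%:Z)
  = dsum (fun m n =>
    q ^+ (m ^ 2 + n ^ 2) * x ^+ n
    * qbinom (q ^+ 2) (L%:Z - m%:Z) n%:Z
    * qbinom (q ^+ 2) n%:Z m%:Z).
Proof.
rewrite (@dsum_reindex _ (fun k j => (j, k - j)%N) L); first last.
- move=> m n; case: (leqP (m + n) L) => mnL.
    by exists (m + n)%N, m; rewrite addKn leq_addr.
  (* For m + n > L the top argument 2(L - m - n) is negative. *)
  by rewrite [qbinom q _ _]qbinom_small ?mulr0 ?mul0r ?eqxx //; lia.
- by move=> k k' m m' mk mk' [mm' kk']; split; lia.
rewrite (@dsum_reindex _ (fun k j => (j, k)) L); first last.
- move=> m n; case: (leqP n L) => nL; last first.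
    by rewrite [qbinom _ _ n]qbinom_small ?mulr0 ?mul0r ?eqxx //; lia.
  case: (leqP m n) => mn; first by exists n, m.
  by rewrite [qbinom _ n m]qbinom_small ?mulr0 ?eqxx //; lia.
- by move=> k k' m m' _ _ [-> ->].
have shuffle (R : comNzRingType) (a b c d e : R) :
  a * b * c * d * e = a * c * (b * d * e) by ring.
apply: eq_bigr => k _ /=; have kL : (k <= L)%N by rewrite -ltnS.
have := congr1 (fun y => q ^+ (k ^ 2) * x ^+ k * y) (convolution (L - k) k).
rewrite !mulr_sumr => e; apply: etrans (etrans e _).
  apply: eq_bigr => j _; have jk : (j <= k)%N by rewrite -ltnS.
  rewrite G_diag //.
  have -> : 2 * L%:Z - 2 * j%:Z - 2 * (k - j)%N%:Z = (2 * (L - k))%N by lia.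
  have -> : L%:Z - j%:Z - (k - j)%N%:Z + ((k - j)./2)%:Z
    = (L - k + (k - j)./2)%N by lia.
  by rewrite subnKC // exprD shuffle.
apply: eq_bigr => j _; have jk : (j <= k)%N by rewrite -ltnS.
rewrite -(qbinom_swap (free_base_q 1)) //.
have -> : L%:Z - j%:Z = (L - k + k - j)%N by lia.
by rewrite [(j ^ 2 + _)%N]addnC exprD shuffle -[_ * _ * qbinom _ k j]mulrA.
Qed.

Theorem theorem1p1 (N : nat) :
  dsum (fun m n =>
    q ^+ G m n
    * qbinom q (2 * N%:Z - 2 * m%:Z - 2 * n%:Z + 2) m%:Z
    * qbinom (q ^+ 4) (N%:Z - m%:Z - n%:Z + 1 + (n./2)%:Z) (n./2)%:Z)
  = dsum (fun m n =>
    q ^+ (m ^ 2 + n ^ 2)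
    * qbinom (q ^+ 2) (N%:Z - m%:Z + 1) n%:Z
    * qbinom (q ^+ 2) n%:Z m%:Z)
  /\
  dsum (fun m n =>
    q ^+ (G m n + 2 * m + 2 * n)
    * qbinom q (2 * N%:Z - 2 * m%:Z - 2 * n%:Z) m%:Z
    * qbinom (q ^+ 4) (N%:Z - m%:Z - n%:Z + (n./2)%:Z) (n./2)%:Z)
  = dsum (fun m n =>
    q ^+ (m ^ 2 + n ^ 2 + 2 * n)
    * qbinom (q ^+ 2) (N%:Z - m%:Z) n%:Z
    * qbinom (q ^+ 2) n%:Z m%:Z).
Proof.
have dsum_ext f g : (forall m n, f m n = g m n) -> dsum f = dsum g.
  by move=> fg; apply: eq_fsbigr => mn _; exact: fg.
split.
(* Taking L = N + 1 absorbs the shifts in the top arguments. *)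
- have eN : N.+1%:Z = N%:Z + 1 by lia.
  apply: etrans (etrans (dsum_identity N.+1 1) _).
    apply: dsum_ext => m n; rewrite expr1n mulr1 eN.
    by congr (_ * qbinom _ _ _ * qbinom _ _ _); lia.
  apply: dsum_ext => m n; rewrite expr1n mulr1 eN.
  by congr (_ * qbinom _ _ _ * _); lia.
(* Here x = q^2 supplies q^(2m+2n) on the left and q^(2n) on the right. *)
- apply: etrans (etrans (dsum_identity N (q ^+ 2)) _).
    apply: dsum_ext => m n; rewrite -(exprM q) -(exprD q).
    by congr (_ ^+ _ * _ * _); lia.
  by apply: dsum_ext => m n; rewrite -(exprM q) -(exprD q).
Qed.
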